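(* If $\lambda<1$, then for the resource pooled system $\mathcal{M}_N'$ operating under the JFFS policy, as $N\to\infty$, $$\frac{Z^{(N)}(\infty)}{N}\ \Rightarrow\ z^*:=\max_{j\in[M]}\Big(\sum_{i=1}^{j-1}\gamma_i+\frac{\lambda-\sum_{i=1}^{j-1}\mu_i\gamma_i}{\mu_j}\Big).$$
   Context: Parameters: $M\in\{1,2,\dots\}$; service rates $\mu_1>\dots>\mu_M>0$; proportions $\gamma_j\in(0,1]$ with $\sum_j\gamma_j=1$ and $\sum_j\gamma_j\mu_j=1$; $\lambda>0$; $N$ ranges over positive integers with $N\gamma_j\in\{1,2,\dots\}$ for all $j\in[M]=\{1,\dots,M\}$; $(x)_+=\max(x,0)$. Resource pooled system $\mathcal{M}_N'$ under the Join-the-Fastest-Free-Server (JFFS) policy: $N$ servers, $N\gamma_j$ of them with rate $\mu_j$, one central queue, Poisson arrivals of rate $N\lambda$, i.i.d. exponential job sizes of mean $1$; the head-of-line job is always given to the fastest idle server, if any. The total number of jobs $Z^{(N)}(t)\in\mathbb{Z}_+$ is the Markov chain with transitions $k\to k+1$ at rate $N\lambda$ and $k\to k-1$ at rate $\sum_{j\in[M]}\mu_j\min\big((k-\sum_{i=1}^{j-1}N\gamma_i)_+,N\gamma_j\big)$. For $\lambda<1$ it is positive recurrent, and $Z^{(N)}(\infty)$ is a random variable with its stationary distribution. $\Rightarrow$ denotes weak convergence. *)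

(* Defs.v *)
From mathcomp Require Export all_boot all_order all_algebra.
From mathcomp Require Export all_classical all_reals all_analysis.
Export Order.TTheory GRing.Theory Num.Theory.
Export numFieldNormedType.Exports.

Set Implicit Arguments.
Unset Strict Implicit.
Unset Printing Implicit Defensive.

Local Open Scope classical_set_scope.
Local Open Scope ring_scope.

(* Continuous-time Markov chains on nat. [p t k l] is the probability of being
   in state l a time t after being in state k; the values at t < 0 are junk. *)
Definition is_transition_function (R : realType)
    (p : R -> nat -> nat -> R) : Prop :=
  [/\ forall (t : R) k l, 0 <= t -> 0 <= p t k l,
      forall (t : R) k, 0 <= t -> (\sum_(0 <= l <oo) (p t k l)%:E = 1)%E,
      forall k l, p 0 k l = (k == l)%:R
    & forall (s t : R) k l, 0 <= s -> 0 <= t ->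
        (\sum_(0 <= m <oo) (p s k m * p t m l)%:E = (p (s + t) k l)%:E)%E].

(* Only the right derivative at 0 is prescribed; when the exit rates [- q k k]
   are bounded, as for the chain below, this determines p. *)
Definition has_rates (R : realType) (p : R -> nat -> nat -> R)
    (q : nat -> nat -> R) : Prop :=
  forall k l, (p h k l - (k == l)%:R) / h @[h --> 0^'+] --> q k l.

Definition is_stationary (R : realType) (p : R -> nat -> nat -> R)
    (nu : probability nat R) : Prop :=
  forall (t : R) l, 0 <= t ->
    (\sum_(0 <= k <oo) (nu [set k] * (p t k l)%:E) = nu [set l])%E.

(* Convergence in law of [X n] to nu along the filter F on the indices; each
   [X n] may live on its own probability space. *)
Definition cvg_in_law (R : realType) (F : set_system nat)
    (d : nat -> measure_display) (T : forall n, measurableType (d n))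
    (P : forall n, probability (T n) R) (X : forall n, T n -> R)
    (nu : probability R R) : Prop :=
  forall f : R -> R, continuous f -> (exists B, forall x, `|f x| <= B) ->
    ('E_(P n)[f \o X n])%E @[n --> F] --> (\int[nu]_x (f x)%:E)%E.

Definition admissible (R : realType) (M : nat) (gamma : 'I_M -> R) : set nat :=
  [set N | (0 < N)%N /\
           forall j, exists2 m : nat, (0 < m)%N & N%:R * gamma j = m%:R].

(* Classes are indexed from 0, so the sum over i < j runs over the classes of
   servers strictly faster than j. *)
Definition jffs_death_rate (R : realType) (M : nat) (mu gamma : 'I_M -> R)
    (N k : nat) : R :=
  \sum_(j < M) mu j *
    Num.min (Num.max (k%:R - \sum_(i < M | (i < j)%N) N%:R * gamma i) 0)
            (N%:R * gamma j).

Definition jffs_rate (R : realType) (M : nat) (mu gamma : 'I_M -> R)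
    (lambda : R) (N k l : nat) : R :=
  if l == k.+1 then N%:R * lambda
  else if k == l.+1 then jffs_death_rate mu gamma N k
  else if k == l then - (N%:R * lambda + jffs_death_rate mu gamma N k)
  else 0.

Definition zstar_term (R : realType) (M : nat) (mu gamma : 'I_M -> R)
    (lambda : R) (j : 'I_M) : R :=
  \sum_(i < M | (i < j)%N) gamma i
  + (lambda - \sum_(i < M | (i < j)%N) mu i * gamma i) / mu j.

(* The default value of the iterated maximum is one of the terms. *)
Definition zstar (R : realType) (M : nat) (M_gt0 : (0 < M)%N)
    (mu gamma : 'I_M -> R) (lambda : R) : R :=
  \big[Num.max/zstar_term mu gamma lambda (Ordinal M_gt0)]_(j < M)
    zstar_term mu gamma lambda j.

(* Main.v *)
Require Import Defs.
From mathcomp Require Import measurable_realfun ring lra.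

(* In the stationary law nu the net flux across each edge {k, k+1} vanishes, so
   the normalized death rates x_k = D(k) / N satisfy
   nu(k+1) x_(k+1) = lambda nu(k).  Summing this identity against x_k - lambda
   telescopes to
   sum_k nu(k) (x_k - lambda)^2 = lambda sum_k nu(k) (x_(k+1) - x_k) = O(1/N).
   Moreover x_k = fluid_rate (k / N), where fluid_rate is concave, strictly
   increasing on [0, 1], and equal to lambda exactly at z*; Chebyshev's
   inequality then forces Z / N to concentrate at z*. *)

Set Implicit Arguments.
Unset Strict Implicit.
Unset Printing Implicit Defensive.

Local Open Scope classical_set_scope.
Local Open Scope ring_scope.

(** * Fluid limit of the total service rate *)

Section fluid.
Context {R : realType} {M : nat}.
Variables (mu gamma : 'I_M -> R).
Hypothesis gamma_gt0 : forall j, 0 < gamma j.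
Hypothesis gamma_sum : \sum_(j < M) gamma j = 1.

(** Breakpoints of the piecewise affine [fluid_rate]. The argument is a [nat] so that the last
    breakpoint, [cumul M], is available too. *)
Definition cumul (n : nat) : R := \sum_(i < M | (i < n)%N) gamma i.

(** With [x] jobs per server, this is the number of busy class-[j] servers as a proportion of all
    servers. *)
Definition busy (j : 'I_M) (x : R) : R :=
  Num.min (Num.max (x - cumul j) 0) (gamma j).

Definition fluid_rate (x : R) : R := \sum_(j < M) mu j * busy j x.

Lemma sum_ltnS (F : 'I_M -> R) (j : 'I_M) :
  \sum_(i < M | (i < j.+1)%N) F i = \sum_(i < M | (i < j)%N) F i + F j.
Proof.
rewrite (bigD1 j) ?ltnS//= addrC; congr (_ + _).
by apply: eq_bigl => i; rewrite ltnS [RHS]ltn_neqAle andbC.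
Qed.

Lemma cumulS (j : 'I_M) : cumul j.+1 = cumul j + gamma j.
Proof. exact: sum_ltnS. Qed.

Lemma cumul_ge0 n : 0 <= cumul n.
Proof. by apply: sumr_ge0 => i _; exact/ltW. Qed.

Lemma cumul0 : cumul 0 = 0.
Proof. by rewrite /cumul big_pred0. Qed.

Lemma cumulM : cumul M = 1.
Proof. by rewrite -gamma_sum; apply: eq_bigl => i; rewrite ltn_ord. Qed.

Lemma le_cumul m n : (m <= n)%N -> cumul m <= cumul n.
Proof.
move=> mn; rewrite /cumul [leRHS](bigID (fun i : 'I_M => (i < m)%N))/=.
rewrite -[leLHS]addr0 lerD//; last by apply: sumr_ge0 => i _; exact/ltW.
rewrite le_eqVlt; apply/orP; left; apply/eqP; apply: eq_bigl => i.
by case: (ltnP i m) => im; rewrite ?andbT ?andbF// (leq_trans im mn).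
Qed.

(** The difference form makes the sum over classes telescope in [sum_busy]. *)
Lemma busyE (j : 'I_M) (x : R) : 0 <= x ->
  busy j x = Num.min x (cumul j.+1) - Num.min x (cumul j).
Proof.
move=> x0; rewrite /busy cumulS; have := gamma_gt0 j.
move: (gamma j) (cumul j) (cumul_ge0 j) => g c c0 g0.
rewrite !minEle !maxEle.
by do ?case: ifPn; rewrite -?ltNge; lra.
Qed.

Lemma busy_ge0 (j : 'I_M) (x : R) : 0 <= busy j x.
Proof. by rewrite /busy le_min le_max lexx orbT /= ltW. Qed.

Lemma busy_le (j : 'I_M) (x : R) : busy j x <= gamma j.
Proof. by rewrite /busy ge_min lexx orbT. Qed.

Lemma le_busy (j : 'I_M) (x y : R) : x <= y -> busy j x <= busy j y.
Proof.
rewrite /busy => xy; move: (gamma j) (cumul j) => g c.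
rewrite !minEle !maxEle.
by do ?case: ifPn; rewrite -?ltNge; lra.
Qed.

Lemma busy_lip (j : 'I_M) (x y : R) : x <= y -> busy j y - busy j x <= y - x.
Proof.
rewrite /busy => xy; move: (gamma j) (cumul j) => g c.
rewrite !minEle !maxEle.
by do ?case: ifPn; rewrite -?ltNge; lra.
Qed.

Lemma sum_busy (x : R) : 0 <= x -> \sum_(j < M) busy j x = Num.min x 1.
Proof.
move=> x0; under eq_bigr do rewrite busyE//.
rewrite -(big_mkord xpredT
  (fun j => Num.min x (cumul j.+1) - Num.min x (cumul j))).
rewrite (telescope_sumr (fun j => Num.min x (cumul j)))// cumulM cumul0.
by rewrite (min_r x0) subr0.
Qed.

Hypothesis mu_decr : forall i j : 'I_M, (i < j)%N -> mu j < mu i.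
Hypothesis mu_gt0 : forall j, 0 < mu j.
Hypothesis capacity : \sum_(j < M) gamma j * mu j = 1.

Lemma mu_nincr (i j : 'I_M) : (i <= j)%N -> mu j <= mu i.
Proof.
rewrite leq_eqVlt => /orP[/eqP/val_inj ->//|/mu_decr/ltW//].
Qed.

(* [fluid_rate] is concave, being the minimum of the lines extending its
   affine pieces. *)
Lemma fluid_rate_le_tangent (j : 'I_M) (x : R) : 0 <= x ->
  fluid_rate x <= \sum_(i < M | (i < j)%N) mu i * gamma i + mu j * (x - cumul j).
Proof.
move=> x0.
(* After subtracting [mu j], the faster classes have positive weights and occupancy at most
   [gamma i], while the others have nonpositive weights. The subtracted part is [mu j * Num.min x 1]
   by [sum_busy]. *)
have : \sum_(i < M) (mu i - mu j) * busy i x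
    <= \sum_(i < M | (i < j)%N) (mu i - mu j) * gamma i.
  rewrite (bigID (fun i : 'I_M => (i < j)%N))/= -[leRHS]addr0 lerD//.
    apply: ler_sum => i /mu_decr/ltW ij.
    by rewrite ler_wpM2l ?subr_ge0// busy_le.
  apply: sumr_le0 => i; rewrite -leqNgt => /mu_nincr ji.
  by rewrite mulr_le0_ge0 ?subr_le0// busy_ge0.
under eq_bigr do rewrite mulrBl.
under [leRHS]eq_bigr do rewrite mulrBl.
rewrite !sumrB -!mulr_sumr sum_busy// -/(fluid_rate x) -/(cumul j).
have : mu j * Num.min x 1 <= mu j * x.
  by rewrite ler_wpM2l ?ge_min ?lexx// ltW.
lra.
Qed.

(** Between these breakpoints the classes faster than [j] are saturated and the slower ones are
    idle. *)
Lemma fluid_rate_tangent (j : 'I_M) (x : R) : cumul j <= x <= cumul j.+1 ->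
  fluid_rate x = \sum_(i < M | (i < j)%N) mu i * gamma i + mu j * (x - cumul j).
Proof.
move=> /andP[jx xj].
rewrite /fluid_rate (bigID (fun i : 'I_M => (i < j)%N))/=; congr (_ + _).
  apply: eq_bigr => i ij; congr (_ * _).
  have := le_cumul ij; rewrite cumulS /busy => ij'.
  have gi := gamma_gt0 i.
  by rewrite max_l ?min_r//; lra.
rewrite (bigD1 j) ?ltnn//= big1 ?addr0.
  rewrite /busy max_l ?subr_ge0// min_l//.
  by move: xj; rewrite cumulS; lra.
move=> i; rewrite -leqNgt => /andP[ij /eqP ji].
have {ji}/le_cumul ij' : (j.+1 <= i)%N.
  by rewrite ltn_neqAle ij andbT; apply/eqP => /val_inj/esym.
rewrite /busy max_r ?min_l ?mulr0//; first exact/ltW.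
by rewrite subr_le0 (le_trans xj).
Qed.

Lemma fluid_rate_lip (x y : R) : x <= y ->
  0 <= fluid_rate y - fluid_rate x <= (\sum_(j < M) mu j) * (y - x).
Proof.
move=> xy; rewrite /fluid_rate -sumrB mulr_suml.
apply/andP; split; [apply: sumr_ge0|apply: ler_sum] => j _; rewrite -mulrBr.
  by rewrite mulr_ge0 ?subr_ge0 ?le_busy// ltW.
by rewrite ler_wpM2l ?busy_lip// ltW.
Qed.

(** Each additional busy server contributes at least [m], and the busy proportion is [Num.min x 1]
    by [sum_busy]. *)
Lemma fluid_rate_incr (m x y : R) : (forall j, m <= mu j) -> 0 <= x -> x <= y ->
  m * (Num.min y 1 - Num.min x 1) <= fluid_rate y - fluid_rate x.
Proof.
move=> mmu x0 xy; rewrite -(sum_busy x0) -(sum_busy (le_trans x0 xy)).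
rewrite /fluid_rate -!sumrB mulr_sumr; apply: ler_sum => j _.
by rewrite -mulrBr ler_wpM2r ?subr_ge0 ?le_busy.
Qed.

(** * The root of [fluid_rate] at level [lambda] *)

Variables (M_gt0 : (0 < M)%N) (lambda : R).
Hypothesis lambda_gt0 : 0 < lambda.
Hypothesis lambda_lt1 : lambda < 1.
Local Notation z := (zstar M_gt0 mu gamma lambda).

Lemma zstar_term_le j : zstar_term mu gamma lambda j <= z.
Proof. exact: le_bigmax. Qed.

Lemma zstar_attained : exists j, z = zstar_term mu gamma lambda j.
Proof.
rewrite /zstar; elim/big_ind: _ => [|x y [i ->] [j ->]|j _].
- by exists (Ordinal M_gt0).
- by rewrite maxEle; case: ifP; [exists j|exists i].
- by exists j.
Qed.

Lemma zstar_gt0 : 0 < z.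
Proof.
apply: lt_le_trans (zstar_term_le (Ordinal M_gt0)).
by rewrite /zstar_term !big_pred0// add0r subr0 divr_gt0.
Qed.

(** A term is below 1 exactly when its line at 1 exceeds [lambda]; that line dominates
    [fluid_rate 1], which is the full capacity 1. *)
Lemma zstar_lt1 : z < 1.
Proof.
have [j ->] := zstar_attained; rewrite /zstar_term -/(cumul j).
rewrite -ltrBrDl ltr_pdivrMr// ltrBlDl (lt_le_trans lambda_lt1)//.
have := @fluid_rate_le_tangent j 1 ler01.
rewrite mulrC; apply: le_trans.
rewrite -[leLHS]capacity le_eqVlt; apply/orP; left; apply/eqP/eq_bigr => i _.
rewrite mulrC /busy min_r// le_max; apply/orP; left.
by have := le_cumul (ltn_ord i); rewrite cumulM cumulS; lra.
Qed.

(** Each term is the abscissa where the line of its class reaches [lambda]. The line attaining the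
    maximum gives the upper bound, the line of the piece containing [z] the lower one. *)
Lemma fluid_rate_zstar : fluid_rate z = lambda.
Proof.
have z0 := ltW zstar_gt0.
apply/eqP; rewrite eq_le; apply/andP; split.
  have [j zj] := zstar_attained.
  apply: le_trans (fluid_rate_le_tangent j z0) _.
  rewrite zj /zstar_term -/(cumul j) addrAC subrr add0r mulrCA divff ?gt_eqF//.
  by rewrite mulr1 addrC subrK.
have P0 : cumul (Ordinal M_gt0) <= z by rewrite cumul0.
(* [j] is the last class whose breakpoint is at most [z]. The next breakpoint exceeds [z] by
   maximality or, for the last class, because [z < 1]. *)
case: (@arg_maxnP _ (Ordinal M_gt0) (fun j : 'I_M => cumul j <= z) val P0) => j jz jmax.
rewrite (@fluid_rate_tangent j) ?jz/=.
  have := zstar_term_le j; rewrite /zstar_term -/(cumul j) -lerBrDl.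
  by rewrite ler_pdivrMr// lerBlDl mulrC.
have [jM|] := ltnP j.+1 M; last first.
  by move=> Mj; have := le_cumul Mj; rewrite cumulM; apply/le_trans/ltW/zstar_lt1.
rewrite leNgt; apply/negP => /ltW /(jmax (Ordinal jM)) /=.
by rewrite ltnn.
Qed.

Lemma fluid_rate_separated (e : R) : 0 < e -> exists2 eta, 0 < eta &
  forall x, 0 <= x -> e <= `|x - z| -> eta <= `|fluid_rate x - lambda|.
Proof.
move=> e0; move: z fluid_rate_zstar zstar_gt0 zstar_lt1 => y <- /ltW y0 y1.
have lastP : (M.-1 < M)%N by rewrite ltn_predL.
pose m := mu (Ordinal lastP).
have mmu j : m <= mu j by apply: mu_nincr; rewrite /= -ltnS prednK.
(* [m] is the slowest rate. Past 1 all servers are busy and the rate stops growing, hence the cap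
   [1 - y]. *)
exists (m * Num.min e (1 - y)).
  by rewrite mulr_gt0 ?mu_gt0// lt_min e0 subr_gt0.
move=> x x0.
have m0 : 0 <= m by apply/ltW/mu_gt0.
have [yx|xy] := leP y x.
  rewrite (ger0_norm (_ : 0 <= x - y)) ?subr_ge0// => eyx.
  apply: le_trans (ler_norm _).
  apply: le_trans (fluid_rate_incr mmu y0 yx).
  rewrite ler_wpM2l// !minEle.
  by do ?case: ifPn; rewrite -?ltNge; lra.
rewrite distrC gtr0_norm ?subr_gt0// => exy.
rewrite distrC; apply: le_trans (ler_norm _).
apply: le_trans (fluid_rate_incr mmu x0 (ltW xy)).
rewrite ler_wpM2l// !minEle.
by do ?case: ifPn; rewrite -?ltNge; lra.
Qed.

Lemma jffs_death_rateE N k : (0 < N)%N ->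
  jffs_death_rate mu gamma N k = N%:R * fluid_rate (k%:R / N%:R).
Proof.
move=> N0; have NR : (N%:R : R) != 0 by rewrite pnatr_eq0 -lt0n.
rewrite /jffs_death_rate /fluid_rate mulr_sumr; apply: eq_bigr => j _.
rewrite mulrCA /busy; congr (_ * _).
rewrite minr_pMr ?ler0n// maxr_pMr ?ler0n// mulr0 mulrBr mulrCA divff// mulr1.
by rewrite -mulr_sumr.
Qed.

End fluid.

Lemma integral_nat_series (R : realType) (nu : probability nat R)
    (g : nat -> \bar R) : (forall k, 0 <= g k)%E ->
  (\int[nu]_k g k = \sum_(0 <= k <oo) nu [set k] * g k)%E.
Proof.
move=> g0.
have -> : [set: nat] = \bigcup_k [set k].
  by apply/seteqP; split => // k _; exists k.
rewrite ge0_integral_bigcup//=.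
  apply: eq_eseriesr => k _.
  rewrite (eq_integral (cst (g k))); last by move=> x /[!inE] ->.
  by rewrite integral_cst// muleC.
by move=> i j _ _ [k [/= <- <-]].
Qed.

(** * Detailed balance from one-sided balance inequalities *)

Section birth_death.
Context {R : realType}.
Variables (nr D : nat -> R) (b : R).
Hypothesis nr_ge0 : forall k, 0 <= nr k.
Hypothesis nr_le1 : forall n, \sum_(k < n) nr k <= 1.

Lemma mass_cvg0 : nr @ \oo --> 0.
Proof.
apply: cvg_series_cvg_0; apply: nondecreasing_is_cvgn.
  by apply/nondecreasing_seqP => n; rewrite /series/= big_nat_recr//= lerDl.
by exists 1 => _ [n _ <-]; rewrite /series/= big_mkord.
Qed.

Hypothesis D_ge0 : forall k, 0 <= D k.
Hypothesis b_gt0 : 0 < b.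
Hypothesis balance0 : nr 1 * D 1 <= nr 0 * b.
Hypothesis balanceS : forall k,
  nr k * b + nr k.+2 * D k.+2 <= nr k.+1 * (b + D k.+1).

(* The net upward flux from k to k.+1 is nonnegative and nondecreasing in k;
   being dominated by the summable masses, it vanishes. *)
Lemma detailed_balance k : nr k.+1 * D k.+1 = nr k * b.
Proof.
pose a k := nr k * b - nr k.+1 * D k.+1.
have aS i : a i <= a i.+1 by rewrite /a; have := balanceS i; lra.
have amono : nondecreasing_seq a by apply/nondecreasing_seqP.
have a0 : 0 <= a k.
  by apply: le_trans (amono _ _ (leq0n k)); rewrite subr_ge0.
suff : a k <= 0 by move=> ak; apply/esym/eqP; rewrite -subr_eq0 eq_le ak.
have nrb : (fun n => nr n * b) @ \oo --> 0.
  by rewrite -(mul0r b); apply: cvgMr_tmp; exact: mass_cvg0.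
rewrite leNgt; apply/negP => ak.
(* At [maxn n k] the flux is at least [a k] by monotonicity, yet at most the mass there times [b],
   which is already below [a k]. *)
have /cvgrPdist_lt /(_ _ ak) [n _ /(_ (maxn n k))] := nrb.
rewrite /= leq_maxl => /(_ isT); rewrite sub0r normrN.
rewrite ger0_norm; last by rewrite mulr_ge0// ltW.
rewrite ltNge => /negP; apply.
apply: le_trans (amono _ _ (leq_maxr n k)) _.
by rewrite /a lerBlDr lerDl mulr_ge0.
Qed.

End birth_death.

(** * Second moment of the service rate around [lambda] *)

Section second_moment.
Context {R : realType}.
Variables (nr x : nat -> R) (lambda c : R).
Hypothesis nr_ge0 : forall k, 0 <= nr k.
Hypothesis nr_le1 : forall n, \sum_(k < n) nr k <= 1.
Hypothesis lambda_ge0 : 0 <= lambda.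
Hypothesis x0 : x 0 = 0.
Hypothesis x_ge0 : forall k, 0 <= x k.
Hypothesis x_lip : forall k, x k.+1 - x k <= c.
Hypothesis balance : forall k, nr k.+1 * x k.+1 = nr k * lambda.

Lemma second_moment_eq n : \sum_(k < n.+1) nr k * (x k - lambda) ^+ 2 =
  lambda * \sum_(k < n) nr k * (x k.+1 - x k) - lambda * nr n * (x n - lambda).
Proof.
elim: n => [|n IH]; first by rewrite big_ord_recr !big_ord0/= x0; ring.
rewrite big_ord_recr IH [in RHS]big_ord_recr/= expr2.
(* The new square is split as [x * (x - lambda) - lambda * (x - lambda)], exposing the product that
   [balance] rewrites. *)
transitivity (lambda * \sum_(i < n) nr i * (x i.+1 - x i)
  - lambda * nr n * (x n - lambda)
  + (nr n.+1 * x n.+1 * (x n.+1 - lambda) - lambda * nr n.+1 * (x n.+1 - lambda))).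
  by congr (_ + _); ring.
by rewrite balance; ring.
Qed.

Lemma second_moment_le n :
  \sum_(k < n) nr k * (x k - lambda) ^+ 2 <= lambda * c.
Proof.
(* The boundary term in [second_moment_eq] is at most [lambda ^+ 2 * nr m] and vanishes as [m]
   grows. The partial sums are nondecreasing, so the limiting bound holds for every [n]. *)
suff le_n m : \sum_(k < m.+1) nr k * (x k - lambda) ^+ 2
    <= lambda * c + lambda ^+ 2 * nr m.
  pose F m := \sum_(k < m.+1) nr k * (x k - lambda) ^+ 2.
  have cvgn : (fun m => lambda * c + lambda ^+ 2 * nr m) @ \oo --> lambda * c.
    rewrite -[X in _ --> X]addr0 -[X in _ + X](mulr0 (lambda ^+ 2)).
    by apply: cvgD; [exact: cvg_cst|apply: cvgMl_tmp; exact: mass_cvg0].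
  apply: (cvgr_to_ge cvgn); near=> m.
  apply: le_trans (le_n m); rewrite -!(big_mkord xpredT (fun k => nr k * (x k - lambda) ^+ 2)).
  have nm : (n <= m.+1)%N by apply: leqW; near: m; exact: nbhs_infty_ge.
  rewrite [leRHS](big_cat_nat _ nm)//= lerDl.
  by apply: sumr_ge0 => i _; rewrite mulr_ge0 ?sqr_ge0.
(* [c] bounds the first increment, which is [x 1]; its sign is needed to use that the total mass is
   at most 1. *)
have c0 : 0 <= c by rewrite (le_trans (x_ge0 1))// -[x _]subr0 -[X in _ - X]x0.
rewrite second_moment_eq.
have : lambda * \sum_(k < m) nr k * (x k.+1 - x k) <= lambda * c.
  rewrite ler_wpM2l//; apply: (@le_trans _ _ (\sum_(k < m) nr k * c)).
    by apply: ler_sum => k _; rewrite ler_wpM2l.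
  by rewrite -mulr_suml ler_piMl.
have : 0 <= lambda * nr m * x m by rewrite !mulr_ge0.
by rewrite mulrBr expr2; lra.
Unshelve. all: by end_near. Qed.

End second_moment.

(** * Balance inequalities from stationarity *)

Section rates.
Context {R : realType}.
Variables (p : R -> nat -> nat -> R) (q : nat -> nat -> R)
  (nu : probability nat R).
Hypothesis p_tr : is_transition_function p.
Hypothesis p_q : has_rates p q.
Hypothesis nu_st : is_stationary p nu.

Definition mass k : R := fine (nu [set k]).

Lemma massE k : nu [set k] = (mass k)%:E.
Proof. by rewrite fineK// fin_num_measure. Qed.

Lemma mass_ge0 k : 0 <= mass k.
Proof. by rewrite fine_ge0. Qed.

Lemma sum_mass_le1 n : \sum_(k < n) mass k <= 1.
Proof.
have nu1 : (1 = \sum_(0 <= k <oo) nu [set k] * 1)%E.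
  have g0 : forall k : nat, (0 <= cst (1 : \bar R) k)%E by [].
  have := integral_nat_series nu g0; rewrite /= => <-.
  rewrite (integral_cst nu measurableT) mul1e.
  by apply/esym; exact: probability_setT.
rewrite -lee_fin nu1 -sumEFin -(big_mkord xpredT (fun k => (mass k)%:E)).
under eq_bigr do rewrite -massE -[nu _]mule1.
by apply: nneseries_lim_ge => k _ _; rewrite mule_ge0.
Qed.

(** Stationarity bounds the truncated sum of [mass k * p h k l] by [mass l]; divide by [h] and let
    [h] decrease to 0. Truncation avoids exchanging this limit with an infinite sum, at the price of
    an inequality. *)
Lemma stationary_rate_le0 n l : (l < n)%N ->
  \sum_(k < n) mass k * q k l <= 0.
Proof.
move=> ln; have [p_ge0 _ _ _] := p_tr.
have : (fun h => \sum_(k < n) mass k * ((p h k l - (k == l :> nat)%:R) / h)) @ 0^'+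
    --> \sum_(k < n) mass k * q k l.
  apply: cvg_big => [|k _]; first exact: add_continuous.
  by apply: cvgMl_tmp; exact: p_q.
move=> /cvgr_to_le; apply; near=> h.
have h0 : 0 < h by near: h; exact: nbhs_right_gt.
under eq_bigr do rewrite mulrA.
rewrite -mulr_suml mulr_le0_ge0//; last by rewrite invr_ge0 ltW.
under eq_bigr do rewrite mulrBr.
(* As [l < n], the diagonal term survives truncation and contributes exactly [mass l]. *)
have -> : \sum_(k < n) (mass k * p h k l - mass k * (k == l :> nat)%:R) =
    \sum_(k < n) mass k * p h k l - mass l.
  rewrite sumrB [X in _ - X](bigD1 (Ordinal ln))//= eqxx mulr1.
  rewrite [X in _ - (_ + X)]big1 ?addr0// => i il.
  by rewrite (_ : (i == l :> nat) = false) ?mulr0//; exact/negbTE.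
rewrite subr_le0.
rewrite -lee_fin -massE -(nu_st _ (ltW h0)) -sumEFin.
rewrite -(big_mkord xpredT (fun i => (mass i * p h i l)%:E)).
under eq_bigr do rewrite EFinM -massE.
by apply: nneseries_lim_ge => k _ _; rewrite mule_ge0// lee_fin p_ge0// ltW.
Unshelve. all: by end_near. Qed.

End rates.

(** Chebyshev's inequality without events: the pointwise majorant [e + K * g] is integrated. *)
Lemma expectation_near d (T : measurableType d) (R : realType)
    (P : probability T R) (Y g : T -> R) (B a e K s : R) :
  measurable_fun [set: T] Y -> measurable_fun [set: T] g ->
  (forall w, `|Y w| <= B) -> (forall w, 0 <= g w) -> 0 <= e -> 0 <= K ->
  (forall w, `|Y w - a| <= e + K * g w) ->
  (\int[P]_w (g w)%:E <= s%:E)%E ->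
  'E_P[Y]%E \is a fin_num /\ `|fine 'E_P[Y]%E - a| <= e + K * s.
Proof.
move=> mY mg YB g0 e0 K0 Yg gs.
have icst (r : \bar R) : (\int[P]_w r = r)%E.
  rewrite (integral_cst P measurableT) -[RHS]mule1; congr (_ * _)%E.
  exact: probability_setT.
have PT : (P [set: T] < +oo)%E by rewrite probability_setT ltry.
have iY : P.-integrable [set: T] (EFin \o Y).
  apply: measurable_bounded_integrable => //.
  exists B; split; first exact: num_real.
  by move=> x Bx w _ /=; apply: le_trans (YB w) (ltW Bx).
have ia : P.-integrable [set: T] (EFin \o cst a).
  exact: finite_measure_integrable_cst.
have fE : 'E_P[Y]%E \is a fin_num by rewrite unlock; exact: integrable_fin_num.
split => //.
rewrite -lee_fin -abse_EFin EFinB fineK//.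
have -> : ('E_P[Y] - a%:E = \int[P]_w (Y w - a)%:E)%E.
  under eq_integral do rewrite EFinB.
  rewrite (@integralB_EFin _ _ _ _ _ Y (cst a))// unlock; congr (_ - _)%E.
  by have := icst a%:E => <-.
have mYa : measurable_fun [set: T] (Y \- cst a) by exact: measurable_funB.
apply: le_trans (le_abse_integral _ _ _) _ => //; first exact/measurable_EFinP.
apply: (@le_trans _ _ (\int[P]_w (e%:E + K%:E * (g w)%:E))%E).
  apply: ge0_le_integral => //=.
  - by do 2 apply: measurableT_comp => //.
  - apply: emeasurable_funD => //; apply: measurable_funeM.
    exact/measurable_EFinP.
  - by move=> w _; rewrite -EFinM -EFinD lee_fin Yg.
have mg' := (measurable_EFinP _ _).2 mg.
rewrite ge0_integralD//=; last 2 first.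
- by move=> w _; rewrite mule_ge0 ?lee_fin.
- exact: measurable_funeM.
rewrite icst ge0_integralZl_EFin//; last by move=> w _; rewrite lee_fin.
by rewrite EFinD EFinM leeD2l// lee_wpmul2l// lee_fin.
Qed.

(** * Balance and concentration for the JFFS chain *)

Section jffs.
Context {R : realType} {M : nat}.
Variables (mu gamma : 'I_M -> R) (lambda : R).
Hypothesis mu_gt0 : forall j, 0 < mu j.
Hypothesis gamma_gt0 : forall j, 0 < gamma j.
Hypothesis lambda_gt0 : 0 < lambda.
Variables (N : nat) (p : R -> nat -> nat -> R) (nu : probability nat R).
Hypothesis N_gt0 : (0 < N)%N.
Hypothesis p_tr : is_transition_function p.
Hypothesis p_q : has_rates p (jffs_rate mu gamma lambda N).
Hypothesis nu_st : is_stationary p nu.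

Local Notation x k := (fluid_rate mu gamma (k%:R / N%:R)).

Lemma fluid_rate0 : fluid_rate mu gamma 0 = 0.
Proof.
rewrite /fluid_rate big1// => j _; rewrite /busy max_r; last first.
  by rewrite sub0r oppr_le0 cumul_ge0.
by rewrite min_l ?mulr0// ltW.
Qed.

Lemma fluid_rate_ge0 y : 0 <= fluid_rate mu gamma y.
Proof.
by apply: sumr_ge0 => j _; rewrite mulr_ge0 ?busy_ge0// ltW.
Qed.

Lemma jffs_balance k : mass nu k.+1 * x k.+1 = mass nu k * lambda.
Proof.
have NR : (0 : R) < N%:R by rewrite ltr0n.
have Nn0 : (N%:R : R) != 0 by rewrite gt_eqF.
apply: (mulfI Nn0); rewrite mulrCA -jffs_death_rateE// mulrCA.
have D_ge0 i : 0 <= jffs_death_rate mu gamma N i.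
  by rewrite jffs_death_rateE// mulr_ge0 ?ler0n// fluid_rate_ge0.
have D0 : jffs_death_rate mu gamma N 0 = 0.
  by rewrite jffs_death_rateE// mul0r fluid_rate0 mulr0.
apply: (detailed_balance (mass_ge0 nu) (sum_mass_le1 nu) D_ge0).
- exact: mulr_gt0.
(* Only states 0 and 1 can have a nonzero rate into 0, so truncation at 2 loses nothing. *)
- have := stationary_rate_le0 p_tr p_q nu_st (isT : (0 < 2)%N).
  by rewrite !big_ord_recl big_ord0/= /jffs_rate/= /bump/= D0 !add1n !addr0; lra.
- move=> i.
  (* Truncation at [i.+3] keeps [i], [i.+1] and [i.+2], the only states that can have a nonzero rate
     into [i.+1]. *)
  have := stationary_rate_le0 p_tr p_q nu_st (leqnSn i.+2).
  rewrite !big_ord_recr/= big1; last first.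
    move=> j _; rewrite /jffs_rate.
    have ji := ltn_ord j.
    rewrite (_ : (i.+1 == j.+1) = false); last by rewrite eqSS gtn_eqF.
    rewrite (_ : (nat_of_ord j == i.+2) = false); last by rewrite ltn_eqF// ltnW// ltnW.
    rewrite (_ : (nat_of_ord j == i.+1) = false); last by rewrite ltn_eqF// ltnW.
    by rewrite mulr0.
  rewrite add0r /jffs_rate !eqxx.
  rewrite (_ : (i.+1 == i.+2) = false); last by rewrite ltn_eqF.
  rewrite (_ : (i.+1 == i.+3) = false); last by rewrite ltn_eqF// ltnW.
  lra.
Qed.

(** One more job shifts the fluid argument by [1 / N], so [fluid_rate_lip] supplies the increment
    bound in [second_moment_le]. *)
Lemma jffs_second_moment :
  (\int[nu]_k ((x k - lambda) ^+ 2)%:E <=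
    (lambda * ((\sum_(j < M) mu j) / N%:R))%:E)%E.
Proof.
have NR : (0 : R) < N%:R by rewrite ltr0n.
rewrite integral_nat_series; last by move=> k; rewrite lee_fin sqr_ge0.
apply: lime_le.
  by apply: is_cvg_nneseries => k _ _; rewrite mule_ge0// lee_fin sqr_ge0.
apply: nearW => n.
under eq_bigr do rewrite massE -EFinM.
rewrite sumEFin lee_fin big_mkord.
apply: (second_moment_le (x := fun k => x k) (mass_ge0 nu) (sum_mass_le1 nu)
  (ltW lambda_gt0)).
- by rewrite mul0r fluid_rate0.
- by move=> k; exact: fluid_rate_ge0.
- move=> k.
  have kk : k%:R / N%:R <= k.+1%:R / N%:R :> R.
    by rewrite ler_pM2r ?invr_gt0// ler_nat.
  have /andP[_] := fluid_rate_lip gamma mu_gt0 kk.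
  by rewrite -mulrBl -natrB// subSnn mul1r.
- exact: jffs_balance.
Qed.

End jffs.

Theorem proposition4 (R : realType) (M : nat) (M_gt0 : (0 < M)%N)
    (mu gamma : 'I_M -> R) (lambda : R)
    (mu_decr : forall i j : 'I_M, (i < j)%N -> mu j < mu i)
    (mu_gt0 : forall j, 0 < mu j)
    (gamma_bounds : forall j, 0 < gamma j <= 1)
    (gamma_sum : \sum_(j < M) gamma j = 1)
    (capacity : \sum_(j < M) gamma j * mu j = 1)
    (lambda_gt0 : 0 < lambda)
    (lambda_lt1 : lambda < 1)
    (p : nat -> R -> nat -> nat -> R)
    (d : nat -> measure_display) (T : forall N, measurableType (d N))
    (P : forall N, probability (T N) R)
    (Z : forall N, {RV (P N) >-> nat})
    (p_transition : forall N, admissible gamma N ->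
       is_transition_function (p N))
    (p_rates : forall N, admissible gamma N ->
       has_rates (p N) (jffs_rate mu gamma lambda N))
    (Z_stationary : forall N, admissible gamma N ->
       is_stationary (p N) (distribution (P N) (Z N))) :
  cvg_in_law (within (admissible gamma) \oo) P
    (fun N w => (Z N w)%:R / N%:R)
    (\d_(zstar M_gt0 mu gamma lambda)).
Proof.
have gamma_gt0 j : 0 < gamma j by case/andP: (gamma_bounds j).
move=> f cf [B fB].
rewrite integral_dirac//; last first.
  by apply/measurable_EFinP; exact: continuous_measurable_fun.
rewrite diracT mul1e; set z := zstar _ _ _ _.
have B0 : 0 <= B by exact: le_trans (fB z).
pose C := \sum_(j < M) mu j.
(* [K] depends on [e] but not on [N]: continuity of [f] covers the outcomes near [z], and the second
   moment covers the rest. *)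
have estimate (e : R) : 0 < e -> exists2 K : R, 0 <= K &
    forall N, admissible gamma N ->
    let X w : R := (Z N w)%:R / N%:R in
    let E := 'E_(P N)[f \o X]%E in
    E \is a fin_num /\ `|fine E - f z| <= e + K * (lambda * (C / N%:R)).
  move=> e0.
  have /cvgrPdist_le /(_ _ e0) /nbhs_ballP [r r0 zr] := cf z.
  have [eta eta0 sep] := fluid_rate_separated gamma_gt0 gamma_sum mu_decr
    mu_gt0 capacity M_gt0 lambda_gt0 lambda_lt1 r0.
  have K0 : 0 <= (B + B) / eta ^+ 2.
    by rewrite divr_ge0 ?addr_ge0// exprn_ge0// ltW.
  (* At distance at least [r] from [z], [g] is at least [eta ^+ 2], so this constant times [g] is at
     least [B + B], which bounds the deviation of [f]. *)
  exists ((B + B) / eta ^+ 2) => // N aN X E; rewrite /E /X.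
  have [N0 _] := aN.
  pose g k := (fluid_rate mu gamma (k%:R / N%:R) - lambda) ^+ 2.
  apply: (@expectation_near _ _ _ _ _ (fun w => g (Z N w)) B).
  - by apply: (measurableT_comp (f := fun k => f (k%:R / N%:R))).
  - exact: (measurableT_comp (f := g)).
  - by move=> w /=.
  - by move=> w; exact: sqr_ge0.
  - exact: ltW.
  - exact: K0.
  - move=> w /=; set y := _ / _.
    have y0 : 0 <= y by rewrite divr_ge0.
    have [zy|yz] := ltP `|y - z| r.
      rewrite distrC (le_trans (zr y _))//; first by rewrite /ball/= distrC.
      by rewrite lerDl mulr_ge0// sqr_ge0.
    have g_ge : eta ^+ 2 <= g (Z N w).
      rewrite /g -(real_normK (num_real (_ - _))).
      by rewrite ler_sqr ?nnegrE//; [exact: sep|exact: ltW].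
    rewrite (le_trans (ler_normB _ _))// (le_trans (lerD (fB _) (fB _)))//.
    rewrite -[leLHS]add0r lerD//; first exact: ltW.
    rewrite -mulrA ler_peMr ?addr_ge0//.
    by rewrite ler_pdivlMl ?mulr1// exprn_gt0.
  - rewrite -(ge0_integral_distribution (Z N) (f := fun k => (g k)%:E)).
    + exact: (jffs_second_moment mu_gt0 gamma_gt0 lambda_gt0 N0
        (p_transition _ aN) (p_rates _ aN) (Z_stationary _ aN)).
    + by [].
    + by move=> k; rewrite lee_fin sqr_ge0.
(* The limit is in the extended reals, so the expectations must first be shown to be eventually
   finite. *)
apply/fine_cvgP; split.
  have [K _ est] := estimate 1 ltr01.
  by rewrite near_withinE; apply: nearW => N /est[].
apply/cvgrPdist_le => e e0.
have e20 : 0 < e / 2 by rewrite divr_gt0.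
have [K K0 est] := estimate _ e20.
have : (fun N => K * (lambda * (C / N%:R))) @ \oo --> 0.
  rewrite (_ : (fun _ => _) = (fun N => K * (lambda * C) * N%:R^-1)); last first.
    by apply/funext => N; rewrite !mulrA.
  rewrite -[X in _ --> X](mulr0 (K * (lambda * C))); apply: cvgMl_tmp.
  apply/gtr0_cvgV0; last exact: cvgr_idn.
  by exists 1%N => // N /=; rewrite ltr0n.
move=> /cvgrPdist_le /(_ _ e20) small.
rewrite near_withinE; apply: filterS small => N /= small aN.
have [_ Ef] := est N aN.
rewrite distrC (le_trans Ef)// [leRHS]splitr lerD2l.
by apply: le_trans small; rewrite sub0r normrN ler_norm.
Qed.
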